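(* Let $K_4$ be the complete $3$-graph on four vertices, i.e. the $3$-graph on vertex set $\{1,2,3,4\}$ with $3$-edges $123,124,134,234$. For every positive integer $n$, $$\frac n2-1\le \mathrm{co^+ex}(n,K_4)\le \frac{2n}{3}.$$
   Context: A $3$-graph is a finite $3$-uniform hypergraph; an edge is written as the concatenation of its vertices. The minimum positive co-degree $\delta_2^+(H)$ of a non-empty $3$-graph $H$ is the maximum $k$ such that every pair of vertices contained in some edge of $H$ is contained in at least $k$ distinct edges of $H$; by convention it is $0$ if $H$ has no edges. A hypergraph is $F$-free if it has no (not necessarily induced) subhypergraph isomorphic to $F$. $\mathrm{co^+ex}(n,F)$ is the maximum of $\delta_2^+(H)$ over all $n$-vertex $F$-free $3$-graphs $H$. *)

(* Defs.v *)
From HB Require Import structures.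
From mathcomp Require Import all_boot all_order all_algebra.

Set Implicit Arguments.
Unset Strict Implicit.
Unset Printing Implicit Defensive.

(* A 3-graph whose vertex set is the whole of T (isolated vertices allowed). *)
Record graph3 (T : finType) := Graph3 {
  edges :> {set {set T}};
  edges_uniform : [forall e in edges, #|e| == 3]
}.

HB.instance Definition _ (T : finType) := [isSub for @edges T].
HB.instance Definition _ (T : finType) := [Finite of graph3 T by <:].

Section Graph3Theory.
Variable T : finType.
Implicit Types (H : graph3 T) (p : {set T}).

Definition codegree H p : nat := #|[set e in edges H | p \subset e]|.

(* Every pair lying in some edge lies in at least k edges. *)
Definition pos_codegree_ge H (k : nat) : bool :=
  [forall p : {set T}, (#|p| == 2) && [exists e in edges H, p \subset e] ==>
                       (k <= codegree H p)].

(* When H has an edge, pos_codegree_ge H k forces k <= #|edges H|, so the range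
   of k below loses nothing. *)
Definition min_pos_codegree H : nat :=
  if edges H == set0 then 0
  else \max_(k < #|edges H|.+1 | pos_codegree_ge H k) k.

(* (S, E) are the vertex set and edge set of a subhypergraph of H. *)
Definition subhypergraph (S : {set T}) (E : {set {set T}}) H : bool :=
  (E \subset edges H) && [forall e in E, e \subset S].

Definition isomorphic_to (U : finType) (F : graph3 U)
    (S : {set T}) (E : {set {set T}}) : bool :=
  [exists f : {ffun U -> T},
    [&& injectiveb f,
        f @: [set: U] == S &
        [set f @: (e : {set U}) | e in edges F] == E]].

Definition graph3_free (U : finType) (F : graph3 U) H : bool :=
  ~~ [exists S : {set T}, exists E : {set {set T}},
        subhypergraph S E H && isomorphic_to F S E].

End Graph3Theory.

(* All notions are invariant under relabelling, so n-vertex 3-graphs are taken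
   on the vertex set 'I_n. *)
Definition coex_pos (U : finType) (n : nat) (F : graph3 U) : nat :=
  \max_(H : graph3 'I_n | graph3_free F H) min_pos_codegree H.

Lemma complete3_uniform (m : nat) :
  [forall e in [set e : {set 'I_m} | #|e| == 3], #|e| == 3].
Proof. by apply/forall_inP => e; rewrite inE. Qed.

Definition complete3 (m : nat) : graph3 'I_m := Graph3 (complete3_uniform m).

Definition K4 : graph3 'I_4 := complete3 4.

(* Main.v *)
Require Import Defs.
From mathcomp Require Import all_boot all_order all_algebra.
From mathcomp Require Import zify lra.

(** Upper bound: for an edge [e] of a [K4]-free 3-graph, a vertex [w] cannot
    extend all three pairs [e :\ x] to edges, as [w |: e] would span a [K4].
    Counting such pairs [(x, w)] gives [3 k <= 2 n].
    Lower bound: split the vertices into [A] and its complement [B] of nearly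
    equal sizes, and take all triples with exactly two vertices in [A].
    Pairs inside [A] have codegree [#|B|], pairs across have codegree
    [#|A| - 1], and pairs inside [B] lie in no edge. *)

Section Graph3Facts.
#[local] Set Implicit Arguments.
#[local] Unset Strict Implicit.
Variable T : finType.
Implicit Types (H : graph3 T) (A S p e : {set T}).

Lemma card_edge H e : e \in edges H -> #|e| = 3.
Proof. by move=> He; apply/eqP; apply: (forall_inP (edges_uniform H)). Qed.

(** Serves both for pairs inside an edge and for triples inside a four-element set. *)
Lemma subset_cardS e S : e \subset S -> #|S| = #|e|.+1 ->
  exists2 v, v \in S & e = S :\ v.
Proof.
move=> sub cS.
have /eqP/cards1P[v Ev] : #|S :\: e| = 1.
  by rewrite cardsD (setIidPr sub) cS subSnn.
have vS : v \in S by have := set11 v; rewrite -Ev inE => /andP[].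
exists v => //; apply/eqP; rewrite eqEcard.
have -> : #|S :\ v| = #|e| by move: cS; rewrite (cardsD1 v) vS => -[].
rewrite leqnn andbT subsetD1 sub /=.
by have := set11 v; rewrite -Ev inE => /andP[].
Qed.

(** * Copies of complete 3-graphs *)

(** Every triple of ['I_m] is an edge of [complete3 m], so any enumeration of an [m]-set [S] whose
    triples are all edges is an embedding; only the vertex set of a copy matters. *)
Lemma complete3_freeP m H :
  reflect (forall S, #|S| = m ->
             (forall e, e \subset S -> #|e| = 3 -> e \in edges H) -> False)
          (graph3_free (complete3 m) H).
Proof.
apply: (iffP idP) => [free S cS HS | noS].
- move/negP: free; apply; apply/existsP; exists S.
  pose f := [ffun i : 'I_m => enum_val (cast_ord (esym cS) i)].
  have f_inj : injective f.
    by move=> i j; rewrite !ffunE => /enum_val_inj /cast_ord_inj.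
  have fS i : f i \in S by rewrite ffunE enum_valP.
  apply/existsP.
  exists [set f @: (e : {set 'I_m}) | e in edges (complete3 m)].
  have sub (e : {set 'I_m}) : f @: e \subset S.
    by apply/subsetP => _ /imsetP[i _ ->].
  rewrite /subhypergraph /isomorphic_to; apply/andP; split.
    apply/andP; split.
      apply/subsetP => _ /imsetP[e + ->]; rewrite inE => /eqP ce.
      by apply: HS => //; rewrite card_imset.
    by apply/forall_inP => _ /imsetP[e _ ->].
  apply/existsP; exists f; apply/and3P; split=> //; first exact/injectiveP.
  by rewrite eqEcard sub card_imset // cardsT card_ord cS leqnn.
- apply/negP => /existsP[S] /existsP[E] /andP[/andP[EH _]].
  case/existsP => f /and3P[/injectiveP f_inj /eqP defS /eqP defE].
  apply: (noS S); first by rewrite -defS card_imset // cardsT card_ord.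
  move=> e eS ce; apply: (subsetP EH); rewrite -defE.
  (* As [e] lies in the image of [f], its preimage is again a triple, hence an edge of
     [complete3 m]. *)
  have fK : f @: (f @^-1: e) = e.
    apply/setP => y; apply/imsetP/idP => [[i]|ye]; first by rewrite inE => ? ->.
    have /imsetP[i _ yi] : y \in f @: [set: 'I_m].
      by rewrite defS (subsetP eS).
    by exists i => //; rewrite inE -yi.
  rewrite -fK; apply: imset_f.
  by rewrite inE -(card_imset _ f_inj) fK ce.
Qed.

(** * Links and codegrees *)

(** A set of vertices rather than of edges, so that the links of different pairs can be double
    counted over [T]. *)
Definition link H p : {set T} := [set v | (v \notin p) && (v |: p \in edges H)].

Lemma codegree_link H p : #|p| = 2 -> codegree H p = #|link H p|.
Proof.
move=> cp; rewrite /codegree.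
have inj : {in link H p &, injective (fun v => v |: p)}.
  move=> u v; rewrite !inE => /andP[up _] /andP[vp _] /setP/(_ u).
  by rewrite /= !inE eqxx (negPf up) => /esym/orP[/eqP|].
rewrite -(card_in_imset inj); congr #|pred_of_set _|.
apply/setP => e; rewrite inE; apply/andP/imsetP => [[He pe] | [v]].
  have [v ve Ep] : exists2 v, v \in e & p = e :\ v.
    by apply: subset_cardS => //; rewrite cp (card_edge He).
  by exists v; rewrite ?inE Ep setD1K // !inE eqxx.
by rewrite inE => /andP[_ He] ->; rewrite subsetUr.
Qed.

(** The point is that [k] falls in the range of the maximum: a pair inside an edge has codegree at
    least [k], and at most the number of edges. *)
Lemma min_pos_codegree_ge H k :
  edges H != set0 -> pos_codegree_ge H k -> k <= min_pos_codegree H.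
Proof.
move=> H0 Hk; rewrite /min_pos_codegree (negPf H0).
have [e He] := set0Pn _ H0.
have [x xe] : exists x, x \in e by apply/card_gt0P; rewrite (card_edge He).
have cp : #|e :\ x| == 2.
  by move: (card_edge He); rewrite (cardsD1 x) xe add1n => -[->].
have kE : k < #|edges H|.+1.
  have /forallP/(_ (e :\ x)) := Hk.
  rewrite cp /=; have -> /= : [exists e' in edges H, e :\ x \subset e'].
    by apply/exists_inP; exists e => //; apply: subD1set.
  move/leq_trans; apply; apply: subset_leq_card.
  by apply/subsetP => e'; rewrite inE => /andP[].
exact: (@leq_bigmax_cond _ (fun i : 'I__ => pos_codegree_ge H i)
          (fun i => i : nat) (Ordinal kE) Hk).
Qed.

(** * Upper bound for [K4]-free 3-graphs *)

Lemma K4_free_codegree H k : graph3_free K4 H -> edges H != set0 ->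
  pos_codegree_ge H k -> 3 * k <= 2 * #|T|.
Proof.
move=> /complete3_freeP free H0 Hk.
have [e He] := set0Pn _ H0; have ce := card_edge He.
have cD x : x \in e -> #|e :\ x| = 2.
  by move=> xe; move: ce; rewrite (cardsD1 x) xe => -[].
have kl x : x \in e -> k <= #|link H (e :\ x)|.
  move=> xe; rewrite -codegree_link ?cD //.
  have /forallP/(_ (e :\ x))/implyP := Hk; apply; rewrite cD //=.
  by apply/exists_inP; exists e => //; apply: subD1set.
have few w : #|[set x in e | w \in link H (e :\ x)]| <= 2.
  (* Since [e] has three elements, the bound 2 says that some [x] in [e] fails. *)
  rewrite -ltnS -ce; apply: proper_card.
  rewrite properE setIdE subsetIl; apply/negP => /subsetP all_x.
  have wl x : x \in e -> w \in link H (e :\ x).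
    by move/all_x; rewrite !inE => /andP[].
  (* If [w] were in [e], it would belong to [e :\ x] for any other [x] in [e], hence not to the link
     of that pair. *)
  have we : w \notin e.
    apply/negP => we.
    have [x xw] : exists x, x \in e :\ w by apply/card_gt0P; rewrite cD.
    move: xw; rewrite !inE => /andP[xw xe].
    by have := wl x xe; rewrite !inE we eq_sym xw.
  apply: (free (w |: e)); first by rewrite cardsU1 we ce.
  move=> e' sub ce'.
  (* A triple of [w |: e] omits one vertex: omitting [w] leaves [e], omitting [v] in [e] leaves an
     edge because [w] is in the link of [e :\ v]. *)
  have [v] : exists2 v, v \in w |: e & e' = (w |: e) :\ v.
    by apply: subset_cardS => //; rewrite cardsU1 we ce ce'.
  case/setU1P=> [->|ve] ->; first by rewrite setU1K.
  have wv : w != v by apply: contraNneq we => ->.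
  have -> : (w |: e) :\ v = w |: (e :\ v).
    apply/setP => y; rewrite !inE.
    by case: (y =P w) => [->|]; rewrite ?wv ?andbT.
  by have := wl v ve; rewrite inE => /andP[].
have le1 : 3 * k <= \sum_(x in e) #|link H (e :\ x)|.
  by rewrite -ce -sum_nat_const; apply: leq_sum.
apply: (leq_trans le1); rewrite mulnC -sum_nat_const.
(* Exchanging the sums counts the pairs [(x, w)] by [w], and [few] bounds each contribution by 2. *)
under eq_bigr => x _ do rewrite -sum1_card big_mkcond.
rewrite exchange_big; apply: leq_sum => w _ /=.
by rewrite -big_mkcondr sum1dep_card.
Qed.

Lemma min_pos_codegree_K4_free H :
  graph3_free K4 H -> 3 * min_pos_codegree H <= 2 * #|T|.
Proof.
move=> free; rewrite mulnC -leq_divRL // /min_pos_codegree.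
case: ifPn => // H0; apply/bigmax_leqP => k Hk.
by rewrite leq_divRL // mulnC; apply: K4_free_codegree Hk.
Qed.

(** * The construction for the lower bound *)

Section TwoOne.
Variable A : {set T}.

Let two_one_edges := [set e : {set T} | (#|e| == 3) && (#|e :&: A| == 2)].

Lemma two_one_uniform : [forall e in two_one_edges, #|e| == 3].
Proof. by apply/forall_inP => e; rewrite inE => /andP[]. Qed.

Definition two_one : graph3 T := Graph3 two_one_uniform.

Lemma two_oneE e : (e \in edges two_one) = (#|e| == 3) && (#|e :&: A| == 2).
Proof. by rewrite inE. Qed.

(** If all triples of a 4-set [S] were edges, deleting [v] would show that [S] has 2 or 3 vertices
    in [A] according to whether [v] is in [A]. So [S] lies inside [A] or misses it, and neither 4 =
    3 nor 0 = 2 holds. *)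
Lemma two_one_free : graph3_free K4 two_one.
Proof.
apply/complete3_freeP => S cS HS.
have cSA v : v \in S -> #|S :&: A| = (v \in A) + 2.
  move=> vS; have cSv : #|S :\ v| = 3.
    by move: cS; rewrite (cardsD1 v) vS => -[].
  have := HS _ (subD1set _ _) cSv; rewrite two_oneE => /andP[_ /eqP <-].
  by rewrite (cardsD1 v) inE vS /= setIDAC.
have [v vS] : exists v, v \in S by apply/card_gt0P; rewrite cS.
case vA : (v \in A).
  have sub : S \subset A.
    apply/subsetP => u uS; have := cSA u uS.
    by rewrite (cSA v) // vA; case: (u \in A).
  by have := cSA v vS; rewrite vA (setIidPl sub) cS.
have [u] : exists u, u \in S :&: A by apply/card_gt0P; rewrite (cSA v) // vA.
by rewrite inE => /andP[uS uA]; have := cSA u uS; rewrite (cSA v) // vA uA.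
Qed.

Lemma card_setU1I v p :
  v \notin p -> #|(v |: p) :&: A| = (v \in A) + #|p :&: A|.
Proof.
move=> vp; rewrite (cardsD1 v) !inE eqxx /=; congr (_ + #|pred_of_set _|).
by rewrite -setIDAC setU1K.
Qed.

Lemma two_one_codegree k :
  k <= #|~: A| -> k < #|A| -> pos_codegree_ge two_one k.
Proof.
move=> kB kA; apply/forallP => p; apply/implyP => /andP[/eqP cp].
case/exists_inP => e He pe; rewrite codegree_link //.
have [v ve Ep] : exists2 v, v \in e & p = e :\ v.
  by apply: subset_cardS => //; rewrite cp (card_edge He).
have vp : v \notin p by rewrite Ep !inE eqxx.
have linkE u : (u \in link two_one p) =
    (u \notin p) && ((u \in A) + #|p :&: A| == 2).
  rewrite inE two_oneE; case up : (u \in p) => //=.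
  by rewrite cardsU1 up cp card_setU1I ?up.
move: He; rewrite two_oneE => /andP[_].
(* If [v] is in [A], the pair [p] crosses the partition and its link is [A :\: p], of size
   [#|A| - 1], whence the strict bound on [k]; otherwise [p] lies inside [A]. *)
rewrite -(setD1K ve) -Ep card_setU1I //; case: (v \in A) => /eqP cpA.
  have {}cpA : #|p :&: A| = 1 by case: cpA.
  have -> : link two_one p = A :\: p.
    by apply/setP => u; rewrite linkE inE cpA; case: (u \in A).
  by rewrite cardsD setIC cpA; lia.
have {}cpA : #|p :&: A| = 2 by [].
have pA : p \subset A by apply/setIidPl/eqP; rewrite eqEcard subsetIl cpA cp.
have -> : link two_one p = ~: A; last by [].
apply/setP => u; rewrite linkE inE cpA.
case uA : (u \in A); first by rewrite andbF.
by rewrite andbT; apply: contraFN uA; apply: (subsetP pA).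
Qed.

Lemma two_one_neq0 : 1 < #|A| -> 0 < #|~: A| -> edges two_one != set0.
Proof.
move=> /card_gt1P[x [y [xA yA xy]]] /card_gt0P[z]; rewrite inE => zA.
apply/set0Pn; exists (z |: [set x; y]); rewrite two_oneE.
have zxy : z \notin [set x; y].
  by apply: contra zA; case/set2P => ->.
rewrite cardsU1 zxy cards2 xy card_setU1I // (negPf zA).
rewrite (setIidPl _) ?cards2 ?xy //.
by apply/subsetP => u /set2P[] ->.
Qed.

Lemma min_pos_codegree_two_one k :
  k <= #|~: A| -> k < #|A| -> k <= min_pos_codegree two_one.
Proof.
(* For [k = 0] there may be no edge at all, but the claim is trivial; a positive [k] makes both
   sides of the partition large enough for an edge. *)
case: k => // k kB kA; apply: min_pos_codegree_ge (two_one_codegree kB kA).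
by apply: two_one_neq0; [apply: leq_trans kA | apply: leq_trans kB].
Qed.

End TwoOne.
End Graph3Facts.

(** * Bounds for [coex_pos n K4] *)

(** With [#|A|] equal to [n / 2] rounded up, the complement has at least [#|A| - 1] vertices in
    either parity, so [#|A| - 1] is an admissible codegree. *)
Lemma coex_pos_K4_ge n : 0 < n -> (uphalf n).-1 <= coex_pos n K4.
Proof.
move=> n_gt0; pose A := [set i : 'I_n | i < uphalf n].
have le_n : uphalf n <= n by lia.
have cA : #|A| = uphalf n.
  rewrite -sum1dep_card (big_ord_narrow_cond (P := xpredT) le_n).
  by rewrite sum1_card card_ord.
have cB : #|~: A| = n - uphalf n by rewrite cardsCs setCK card_ord cA.
apply: leq_trans (@leq_bigmax_cond _ (fun H => graph3_free K4 H) _ _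
  (two_one_free A)).
by apply: min_pos_codegree_two_one; rewrite ?cA ?cB; lia.
Qed.

Lemma coex_pos_K4_le n : 3 * coex_pos n K4 <= 2 * n.
Proof.
(* Dividing first turns the claim into a single bound on a maximum, which can be checked term by
   term. *)
rewrite mulnC -leq_divRL //; apply/bigmax_leqP => H free.
by rewrite leq_divRL // mulnC -[n in 2 * n]card_ord min_pos_codegree_K4_free.
Qed.

Local Open Scope ring_scope.

Theorem theorem11 (n : nat) (hn : (0 < n)%N) :
  n%:R / 2 - 1 <= (coex_pos n K4)%:R :> rat /\
  (coex_pos n K4)%:R <= 2 * n%:R / 3 :> rat.
Proof.
(* Written without truncated subtraction, so that the inequality survives the cast to [rat]. *)
have lower : (n <= 2 * coex_pos n K4 + 2)%N.
  by have := coex_pos_K4_ge _ hn; lia.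
have upper := coex_pos_K4_le n.
move: lower upper; rewrite -!(Num.Theory.ler_nat rat).
rewrite GRing.natrD !GRing.natrM => lower upper.
by split; lra.
Qed.
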